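(* Let $\kappa$ be any cardinal, let $d\geq 1$, and let $\kappa_1,\dots,\kappa_d$ be uncountable regular cardinals such that $\kappa_1>\kappa$ and $\kappa_{i+1}>2^{\kappa_i}$ for all $i<d$. Then for every function $f:\kappa_1\times\cdots\times\kappa_d\to\kappa$ there exist stationary sets $\kappa_1'\subseteq\kappa_1,\dots,\kappa_d'\subseteq\kappa_d$ such that $f$ is constant on $\kappa_1'\times\cdots\times\kappa_d'$.
   Context: A subset of a regular uncountable cardinal $\nu$ is stationary if it meets every closed unbounded subset of $\nu$. *)

(* Defs.v *)
(* Stdlib + mathcomp ordinals ('I_d) world.  Cardinals are modelled as
   well-ordered types (initial ordinals); cardinal comparison via injections. *)
From mathcomp Require Export all_boot.
Set Implicit Arguments. Unset Strict Implicit. Unset Printing Implicit Defensive.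

Definition card_le (A B : Type) : Prop := exists f : A -> B, injective f.
Definition card_lt (A B : Type) : Prop := card_le A B /\ ~ card_le B A.

Section WO.
Variables (T : Type) (lt : T -> T -> Prop).

Definition le (x y : T) : Prop := lt x y \/ x = y.

Definition is_well_order : Prop :=
  well_founded lt /\ (forall x y z, lt x y -> lt y z -> lt x z) /\
  (forall x, ~ lt x x) /\ (forall x y, lt x y \/ x = y \/ lt y x).

(* T is (the order type of) a cardinal: an initial ordinal, i.e. every proper
   initial segment has strictly smaller cardinality *)
Definition is_initial : Prop := forall x : T, ~ card_le T {y : T | lt y x}.

Definition unbounded (A : T -> Prop) : Prop :=
  forall x, exists y, A y /\ le x y.

Definition is_lub (S : T -> Prop) (b : T) : Prop :=
  (forall s, S s -> le s b) /\ (forall u, (forall s, S s -> le s u) -> le b u).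

Definition closed (C : T -> Prop) : Prop :=
  forall S : T -> Prop, (exists s, S s) -> (forall s, S s -> C s) ->
  forall b, is_lub S b -> C b.

Definition club (C : T -> Prop) : Prop := closed C /\ unbounded C.

Definition stationary (S : T -> Prop) : Prop :=
  forall C, club C -> exists x, C x /\ S x.

Definition regular : Prop :=
  forall A : T -> Prop, unbounded A -> card_le T {x : T | A x}.

Definition uncountable : Prop := ~ card_le T nat.

Definition uncountable_regular_cardinal : Prop :=
  is_well_order /\ is_initial /\ regular /\ uncountable.
End WO.

(* Main.v *)
(* Induct on the number of leading coordinates f depends on.  For f depending
   on the first m+1 coordinates, fix the value b of coordinate m: by induction
   f(., b) is constant, with value c_b, on a product of stationary sets S_i^b
   (i < m).  As |K| < kappa_m, some value c equals c_b for stationarily many b,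
   and as 2^kappa_i < kappa_m, shrinking this stationary set once for each i < m
   makes every S_i^b independent of b.  Both pigeonhole steps rest on the fact
   that fewer than kappa clubs of a regular uncountable kappa meet in a club. *)

Require Import Defs.
From Stdlib Require Import Classical ClassicalEpsilon FunctionalExtensionality PropExtensionality ProofIrrelevance.
From mathcomp Require Import all_boot.
Set Implicit Arguments. Unset Strict Implicit. Unset Printing Implicit Defensive.

Lemma dependent_choice (A : Type) (B : A -> Type) (P : forall a, B a -> Prop) :
  (forall a, exists b, P a b) -> exists g : forall a, B a, forall a, P a (g a).
Proof.
move=> H; exists (fun a => proj1_sig (constructive_indefinite_description _ (H a))).
by move=> a; case: constructive_indefinite_description.
Qed.

Lemma card_le_refl A : card_le A A.
Proof. by exists id. Qed.

Lemma card_le_trans A B C : card_le A B -> card_le B C -> card_le A C.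
Proof. by move=> [f injf] [g injg]; exists (g \o f) => a b /injg /injf. Qed.

Lemma card_le_powerset A : card_le A (A -> Prop).
Proof. by exists (fun a b => a = b) => a b /(congr1 (fun P => P b)) ->. Qed.

Lemma card_le_prop_bool A : card_le (A -> Prop) (A -> bool).
Proof.
exists (fun P a => if excluded_middle_informative (P a) then true else false).
move=> P Q e; apply: functional_extensionality => a.
move: (congr1 (fun h => h a) e) => /=.
case: (excluded_middle_informative (P a)); case: (excluded_middle_informative (Q a));
  by move=> // ? ? _; apply: propositional_extensionality; tauto.
Qed.

Lemma card_le_chain (T : nat -> Type) n :
  (forall i, i.+1 < n -> card_le (T i) (T i.+1)) ->
  forall i j, i <= j -> j < n -> card_le (T i) (T j).
Proof.
move=> step i; elim=> [|j IHj] ij jn; first by move: ij; rewrite leqn0 => /eqP ->; exact: card_le_refl.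
move: ij; rewrite leq_eqVlt ltnS => /orP [/eqP -> | ij]; first exact: card_le_refl.
exact: card_le_trans (IHj ij (ltnW jn)) (step j jn).
Qed.

Section WellOrder.
Variables (T : Type) (lt : T -> T -> Prop).
Hypothesis W : is_well_order lt.

Lemma well_founded_min (P : T -> Prop) :
  (exists x, P x) -> exists m, P m /\ forall y, P y -> ~ lt y m.
Proof.
case: W => wf _ [x Px]; elim/(well_founded_ind wf): x Px => x IH Px.
case: (classic (exists y, P y /\ lt y x)) => [[y [Py yx]]|H]; first exact: IH y yx Py.
by exists x; split=> // y Py yx; apply: H; exists y.
Qed.

Lemma le_trans x y z : le lt x y -> le lt y z -> le lt x z.
Proof.
case: W => _ [tr _] [xy|->] [yz|<-]; rewrite /le; auto.
by left; exact: tr xy yz.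
Qed.

Lemma le_of_not_lt x y : ~ lt y x -> le lt x y.
Proof. by case: W => _ [_ [_ tri]] yx; case: (tri x y) => [|[|]]; rewrite /le; auto. Qed.

Lemma bounded_has_lub (S : T -> Prop) :
  (exists b, forall s, S s -> le lt s b) -> exists b, is_lub lt S b.
Proof.
move=> /well_founded_min [m [Sm minm]].
by exists m; split=> // u Su; apply: le_of_not_lt => um; exact: minm u Su um.
Qed.

Lemma is_lub_interleave (s t : nat -> T) b :
  (forall k, le lt (s k) (t k)) -> (forall k, lt (t k) (s k.+1)) ->
  is_lub lt (fun z => exists k, s k = z) b -> is_lub lt (fun z => exists k, t k = z) b.
Proof.
move=> st ts [ub lub]; split.
  by move=> _ [k <-]; apply: le_trans (ub _ (ex_intro _ k.+1 erefl)); left.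
move=> u tu; apply: lub => _ [k <-]; apply: le_trans (st k) _.
exact: tu _ (ex_intro _ k erefl).
Qed.

Hypothesis reg : regular lt.

Lemma small_image_bounded (J : Type) (g : J -> T) :
  ~ card_le T J -> exists b, forall j, lt (g j) b.
Proof.
move=> small; case: (classic (unbounded lt (fun y => exists j, g j = y))) => [unb|].
  case: small; have [h injh] := reg unb.
  have [pre preP] := dependent_choice (fun p : {y | exists j, g j = y} => proj2_sig p).
  exists (pre \o h) => a b /(congr1 g); rewrite /= !preP => e; apply: injh.
  exact: eq_sig_hprop (fun _ => proof_irrelevance _) _ _ e.
move=> /not_all_ex_not [b nb]; exists b => j.
case: W => _ [_ [_ tri]]; case: (tri (g j) b) => [//|gjb]; case: nb; exists (g j).
by split; [exists j | case: gjb => [->|]; [right|left]].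
Qed.

End WellOrder.

Section Stationary.
Variables (T : Type) (lt : T -> T -> Prop).
Hypothesis kappa : uncountable_regular_cardinal lt.

Lemma club_bigcap (J : Type) (C : J -> T -> Prop) :
  (forall j, club lt (C j)) -> ~ card_le T J -> club lt (fun x => forall j, C j x).
Proof.
case: kappa => W [_ [reg unc]] clubC small; split.
  by move=> S neS SC b lubS j; exact: (proj1 (clubC j)) S neS (fun s Ss => SC s Ss j) b lubS.
move=> x.
have [next nextP] : exists next : J -> T -> T, forall j y, C j (next j y) /\ le lt y (next j y).
  apply: (dependent_choice (P := fun j g => forall y, C j (g y) /\ le lt y (g y))) => j.
  by apply: (dependent_choice (P := fun y z => C j z /\ le lt y z)) => y; exact: (proj2 (clubC j)).
have [above aboveP] : exists above : T -> T, forall y j, lt (next j y) (above y).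
  by apply: (dependent_choice (P := fun y b => forall j, lt (next j y) b)) => y;
    exact: small_image_bounded.
(* An omega-sequence starting at x that jumps over every [next j] at each step. *)
pose s k := iter k above x.
have [b bP] := small_image_bounded W reg s unc.
have [y lub_y] : exists y, is_lub lt (fun z => exists k, s k = z) y.
  by apply: bounded_has_lub => //; exists b => _ [k <-]; left.
exists y; split; last by apply: (proj1 lub_y); exists 0.
move=> j; apply: (proj1 (clubC j) (fun z => exists k, next j (s k) = z)).
- by exists (next j (s 0)), 0.
- by move=> _ [k <-]; case: (nextP j (s k)).
- by apply: is_lub_interleave lub_y => // k; case: (nextP j (s k)).
Qed.

Lemma stationary_nonempty S : stationary lt S -> exists x, S x.
Proof.
move=> statS; have [x [_ Sx]] := statS (fun _ => True) (conj (fun _ _ _ _ _ => I)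
  (fun x => ex_intro _ x (conj I (or_intror erefl)))).
by exists x.
Qed.

Lemma stationary_setT : stationary lt (fun _ => True).
Proof.
case: kappa => _ [_ [_ unc]] C [_ unbC].
case: (classic (inhabited T)) => [[t]|empty].
  by have [y [Cy _]] := unbC t; exists y.
by case: unc; exists (fun _ => 0) => a; case: empty.
Qed.

(* Otherwise the clubs avoiding the fibres of h would meet in a club avoiding S. *)
Lemma stationary_pigeonhole (J : Type) (S : T -> Prop) (h : T -> J) :
  stationary lt S -> ~ card_le T J ->
  exists j, stationary lt (fun x => S x /\ h x = j).
Proof.
move=> statS small; apply: NNPP => none.
have [C CP] : exists C : J -> T -> Prop, forall j,
    club lt (C j) /\ forall x, C j x -> ~ (S x /\ h x = j).
  apply: (dependent_choice (P := fun j D => club lt D /\ forall x, D x -> ~ (S x /\ h x = j))).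
  move=> j; have [D notD] := not_all_ex_not _ _ (not_ex_all_not _ _ none j).
  have [clubD noD] := imply_to_and _ _ notD.
  by exists D; split=> // x Dx Sx; apply: noD; exists x.
have [x [Cx Sx]] := statS _ (club_bigcap (fun j => proj1 (CP j)) small).
exact: (proj2 (CP (h x))) x (Cx (h x)) (conj Sx erefl).
Qed.

Lemma stationary_homogeneous (I : eqType) (J : I -> Type) (h : forall i, T -> J i)
    (s : seq I) (S : T -> Prop) :
  stationary lt S -> (forall i, i \in s -> ~ card_le T (J i)) ->
  exists S', [/\ stationary lt S', forall x, S' x -> S x &
    forall i, i \in s -> forall x y, S' x -> S' y -> h i x = h i y].
Proof.
move=> statS; elim: s => [|i s IHs] small.
  by exists S; split.
have [S' [statS' S'S hS']] := IHs (fun k ks => small k (mem_behead (s := i :: s) ks)).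
have [v statv] := stationary_pigeonhole (h i) statS' (small i (mem_head i s)).
exists (fun x => S' x /\ h i x = v); split=> [//|x [/S'S]//|k].
rewrite in_cons => /orP [/eqP -> | ks] x y [S'x hx] [S'y hy]; first by rewrite hx hy.
exact: hS'.
Qed.
End Stationary.

Section Product.
Local Unset Implicit Arguments.
Variables (K : Type) (d : nat) (T : nat -> Type) (lt : forall i : nat, T i -> T i -> Prop).
Hypothesis kappa : forall i : 'I_d, uncountable_regular_cardinal (lt i).
Hypothesis small_K : forall i : 'I_d, ~ card_le (T i) K.
Hypothesis powerset_small : forall i j : 'I_d, i < j -> ~ card_le (T j) (T i -> Prop).

Definition depends_below (m : nat) (f : (forall i : 'I_d, T i) -> K) : Prop :=
  forall x y, (forall i : 'I_d, i < m -> x i = y i) -> f x = f y.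

Definition stationary_homogeneous_below (m : nat) (f : (forall i : 'I_d, T i) -> K) : Prop :=
  exists S : forall i : 'I_d, T i -> Prop,
    (forall i : 'I_d, stationary (lt i) (S i)) /\
    exists c : K, forall x, (forall i : 'I_d, i < m -> S i (x i)) -> f x = c.

Lemma homogeneous_below0 f : depends_below 0 f -> stationary_homogeneous_below 0 f.
Proof.
move=> f_const.
have [x0 _] := dependent_choice (fun i => stationary_nonempty (stationary_setT (kappa i))).
exists (fun i _ => True); split=> [i|]; first exact: stationary_setT.
by exists (f x0) => x _; apply: f_const.
Qed.

Lemma homogeneous_belowS m (md : m < d) :
  (forall g, depends_below m g -> stationary_homogeneous_below m g) ->
  forall f, depends_below m.+1 f -> stationary_homogeneous_below m.+1 f.
Proof.
move=> IHm f f_dep; pose j := Ordinal md.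
have homog_b : forall b : T j, exists Sb : forall i : 'I_d, T i -> Prop,
    (forall i : 'I_d, stationary (lt i) (Sb i)) /\ exists c,
      forall x, (forall i : 'I_d, i < m -> Sb i (x i)) -> f (dfwith x b) = c.
  move=> b; apply: IHm => x y xy; apply: f_dep => i im.
  case: (eqVneq j i) => [<-|ji]; first by rewrite !dfwith_in.
  by rewrite !dfwith_out // xy // -ltnS ltn_neqAle im eq_sym ji.
have [Sb SbP] := dependent_choice homog_b.
have [c cP] := dependent_choice (fun b => proj2 (SbP b)).
have [c0 statA] := stationary_pigeonhole (kappa j) c (stationary_setT (kappa j)) (small_K j).
pose below := [seq i <- enum 'I_d | (i : 'I_d) < m].
have below_small : forall i, i \in below -> ~ card_le (T j) (T i -> Prop).
  by move=> i; rewrite mem_filter => /andP [im _]; apply: powerset_small.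
have [A [statA' A'A Sb_const]] :=
  stationary_homogeneous (kappa j) (fun i b => Sb b i) statA below_small.
have [b0 Ab0] := stationary_nonempty statA'.
exists (dfwith (fun i => Sb b0 i) A); split.
  by move=> i; case: dfwithP => // i' _; exact: (proj1 (SbP b0)).
exists c0 => x xS.
have Axj : A (x j) by move: (xS j (ltnSn m)); rewrite dfwith_in.
have -> : f x = f (dfwith x (x j)) by apply: f_dep => i _; case: dfwithP.
rewrite cP; first by case: (A'A _ Axj).
move=> i im; rewrite (Sb_const i _ _ _ Axj Ab0); last by rewrite mem_filter im mem_enum.
have ji : j != i by rewrite neq_ltn im orbT.
by move: (xS i (ltnW im)); rewrite dfwith_out.
Qed.

Lemma homogeneous_below_all m : m <= d ->
  forall f, depends_below m f -> stationary_homogeneous_below m f.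
Proof.
elim: m => [_|m IHm md]; first exact: homogeneous_below0.
exact: homogeneous_belowS md (IHm (ltnW md)).
Qed.
End Product.

Theorem mainTheorem3 (K : Type) (d : nat) (T : nat -> Type)
  (lt : forall i : nat, T i -> T i -> Prop)
  (hd : 0 < d)
  (hreg : forall i : nat, i < d -> uncountable_regular_cardinal (lt i))
  (hK : card_lt K (T 0))
  (hexp : forall i : nat, i.+1 < d -> card_lt (T i -> bool) (T i.+1))
  (f : (forall i : 'I_d, T i) -> K) :
  exists S : forall i : 'I_d, T i -> Prop,
    (forall i : 'I_d, stationary (lt i) (S i)) /\
    exists c : K, forall x : forall i : 'I_d, T i,
      (forall i : 'I_d, S i (x i)) -> f x = c.
Proof.
have powerset_le i : card_le (T i -> Prop) (T i -> bool) := card_le_prop_bool (T i).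
have mono : forall i j, i <= j -> j < d -> card_le (T i) (T j).
  apply: card_le_chain => i id; apply: card_le_trans (card_le_powerset _) _.
  exact: card_le_trans (powerset_le i) (proj1 (hexp i id)).
have kappa (i : 'I_d) : uncountable_regular_cardinal (lt i) := hreg i (ltn_ord i).
have small_K (i : 'I_d) : ~ card_le (T i) K.
  by move/(card_le_trans (mono 0 i isT (ltn_ord i))); case: hK.
have powerset_small (i j : 'I_d) : i < j -> ~ card_le (T j) (T i -> Prop).
  move=> ij /(card_le_trans (mono i.+1 j ij (ltn_ord j))) /card_le_trans le_pow.
  by case: (hexp i (leq_ltn_trans ij (ltn_ord j))) => _; apply; apply: le_pow.
have f_dep : forall x y, (forall i : 'I_d, i < d -> x i = y i) -> f x = f y.
  move=> x y xy; congr f; apply: functional_extensionality_dep => i.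
  exact: xy i (ltn_ord i).
have [S [statS [c Sc]]] :=
  homogeneous_below_all K d T lt kappa small_K powerset_small d (leqnn d) f f_dep.
by exists S; split=> //; exists c => x xS; apply: Sc => i _.
Qed.
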